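(* Let $n \geqslant 19$ be an integer. Then for every vertex $v$ of $\mathfrak{R}_{S_n}$ we have $\deg v \geqslant \frac{1}{2} n!$, where $\deg v$ is the degree of $v$ in the graph $\mathfrak{R}_{S_n}$.
   Context: $S_n$ denotes the symmetric group on $\{1,\ldots,n\}$. For a finite group $G$, let $\mathcal{N}_G$ be the simple graph whose vertices are the elements of $G$, with $x, y \in G$ joined by an edge if and only if the subgroup $\langle x, y\rangle$ is not nilpotent. The non-nilpotent graph $\mathfrak{R}_G$ is the graph obtained from $\mathcal{N}_G$ by removing all isolated vertices. *)

(* Defs.v *)
From mathcomp Require Import all_boot all_order all_algebra.
From mathcomp Require Import all_fingroup all_solvable.

Set Implicit Arguments.
Unset Strict Implicit.
Unset Printing Implicit Defensive.

(* A simple graph on the vertex type T is given by its adjacency relation e;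
   symmetry and irreflexivity are proved for the graphs defined below. *)

Definition degree (T : finType) (e : rel T) (v : T) : nat := #|[set w | e v w]|.

Definition isolated (T : finType) (e : rel T) (v : T) : bool :=
  [forall w, ~~ e v w].

Definition nonnil_rel (gT : finGroupType) : rel gT :=
  [rel x y | ~~ nilpotent <<[set x; y]>>%g].

Lemma nonnil_rel_sym (gT : finGroupType) : symmetric (@nonnil_rel gT).
Proof. by move=> x y; rewrite /nonnil_rel /= setUC. Qed.

Lemma nonnil_rel_irr (gT : finGroupType) : irreflexive (@nonnil_rel gT).
Proof.
by move=> x; rewrite /nonnil_rel /= setUid abelian_nil ?cycle_abelian.
Qed.

(* The non-nilpotent graph, as an induced subgraph: its vertex type is the
   subtype of non-isolated elements, and its edges are those of nonnil_rel. *)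
Definition Rvertex (gT : finGroupType) : finType :=
  {x : gT | ~~ isolated (@nonnil_rel gT) x}.

Definition Rgraph (gT : finGroupType) : rel (Rvertex gT) :=
  [rel x y | nonnil_rel (val x) (val y)].

Lemma Rgraph_sym (gT : finGroupType) : symmetric (@Rgraph gT).
Proof. by move=> x y; exact: nonnil_rel_sym. Qed.

Lemma Rgraph_irr (gT : finGroupType) : irreflexive (@Rgraph gT).
Proof. by move=> x; exact: nonnil_rel_irr. Qed.

(* Main.v *)
Require Import Defs.
From mathcomp Require Import all_boot all_order all_algebra.
From mathcomp Require Import all_fingroup all_solvable.
From mathcomp Require Import zify.

Set Implicit Arguments.
Unset Strict Implicit.
Unset Printing Implicit Defensive.

Import GroupScope.

(** Since the identity is isolated, it suffices to prove that, for [v != 1], at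
    most half of all permutations [y] generate a nilpotent group with [v].

    Let [p] be a prime divisor of the order of [v], let [x != 1] be the
    [p]-part of [v], and let [P] be the largest power of [p] dividing [n!].
    The element [y ^+ P] has order prime to [p], so if [<v, y>] is nilpotent
    then [y ^+ P] commutes with [x] ([nilpotent_commute_constt]).  Fix a point
    [a] moved by [x].  A permutation [y] for which [z := y ^+ P] commutes with
    [x] satisfies at least one of the following.
    - [z a = a].  Then the length of the [y]-cycle of [a] divides [P], so it is
      one of the [1 + trunc_log p n] powers of [p] that are at most [n].  As the
      cycle of [a] in a random permutation has each given length with
      probability [1/n], this has probability at most [(1 + trunc_log p n) / n]
      ([card_fix_ppow]), hence at most 3/8.
    - [z a = x^-1 a].  Relabelling the point [z a] shows that this has
      probability at most [1 / (n - 1)] ([card_powX_eq]).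
    - [z (x a) = x (z a)] while [z a] is neither [a] nor [x^-1 a].  Relabelling
      the point [z (x a)] keeps [a], [x a] and [z a], and the equation holds
      for only one of the labels, so this has probability at most
      [1 / (n - 3)] ([card_powX_commute]).
    For [n >= 19] the sum of these is at most 3/8 + 1/18 + 1/16 < 1/2. *)

(** * The length of the cycle through a given point *)

Section OrbitLength.
Variable T : finType.
Implicit Types (s y : {perm T}) (a : T) (A : {set T}).

Lemma porbit_sub_closed s a A :
  a \in A -> (forall u, u \in A -> s u \in A) -> porbit s a \subset A.
Proof.
move=> aA sA; apply/subsetP=> _ /porbitP[i ->]; elim: i => [|i IHi].
  by rewrite expg0 perm1.
by rewrite expgSr permM sA.
Qed.

Lemma porbit_fix s a : s a = a -> porbit s a = [set a].
Proof.
move=> sa; apply/eqP; rewrite eqEsubset sub1set porbit_id andbT.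
by apply: porbit_sub_closed => [|u /set1P->]; rewrite ?sa set11.
Qed.

Lemma perm_in_porbit s a u : u \in porbit s a -> s u \in porbit s a.
Proof.
rewrite -!eq_porbit_mem => /eqP<-.
by have := porbit_perm s 1 u; rewrite expg1 => ->.
Qed.

(** Multiplying by [tperm a (y a)] makes [a] a fixed point and redirects the
    arrow that ended in [a] to [y a]: the point [a] is cut out of its cycle. *)
Lemma card_porbit_cut y a :
  y a != a -> #|porbit y a| = #|porbit (y * tperm a (y a)) (y a)|.+1.
Proof.
set s := y * _ => ya.
have sE u : s u = tperm a (y a) (y u) by rewrite permM.
have aNs : a \notin porbit s (y a).
  by rewrite porbit_sym porbit_fix ?sE ?tpermR // inE.
have yE u : y u = tperm a (y a) (s u) by rewrite sE tpermK.
suff -> : porbit y a = a |: porbit s (y a) by rewrite cardsU1 aNs.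
apply/eqP; rewrite eqEsubset subUset sub1set porbit_id /=; apply/andP; split.
  apply: porbit_sub_closed => [|u]; first exact: setU11.
  case/setU1P=> [->|us]; first by rewrite setU1r ?porbit_id.
  rewrite yE; case: tpermP => _; rewrite ?setU11 ?setU1r ?porbit_id //.
  by rewrite perm_in_porbit.
apply: porbit_sub_closed => [|u uy]; first by rewrite perm_in_porbit ?porbit_id.
by rewrite sE; case: tpermP => _; rewrite ?perm_in_porbit ?porbit_id.
Qed.

(** For [1 <= l <= #|A|] this is an equality: every cycle length of [a] is
    equally likely.  The induction on [l] splits according to the image [w] of
    [a] and cuts [a] out, which leaves a permutation of [A :\ a] in which the
    cycle of [w] has length [l - 1]; this is why permutations of an arbitrary
    subset are counted. *)
Lemma card_porbit_eq_leq l A a : a \in A ->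
  #|[set y in perm_on A | #|porbit y a| == l]| <= (#|A|.-1)`!.
Proof.
elim: l A a => [|l IHl] A a aA.
  by rewrite eq_card0 // => y; rewrite !inE (negPf (card_porbit_neq0 _ _)) andbF.
have cA : #|A :\ a| = #|A|.-1 by rewrite (cardsD1 a A) aA.
case: l IHl => [_|l IHl].
  rewrite -cA -card_perm subset_leq_card //; apply/subsetP=> y.
  rewrite !inE => /andP[yA /cards1P[u yu]].
  have ya : y a = a.
    have := porbit_id y a; have := perm_in_porbit (porbit_id y a).
    by rewrite yu => /set1P-> /set1P->.
  apply/subsetP=> w; rewrite !inE => yw.
  rewrite (subsetP yA) // andbT.
  by apply: contraNneq yw => ->; rewrite ya.
rewrite -sum1_card.
rewrite (partition_big (fun y : {perm T} => y a) [in A :\ a]) /=; last first.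
  move=> y; rewrite !inE => /andP[yA /eqP L].
  rewrite (perm_closed _ yA) aA andbT.
  by apply/eqP=> ya; move: L; rewrite porbit_fix // cards1.
apply: (@leq_trans (\sum_(w in A :\ a) (#|A :\ a|.-1)`!)); last first.
  by rewrite sum_nat_const cA; case: #|A|.-1.
apply: leq_sum => w wA; apply: leq_trans (IHl _ _ wA).
rewrite sum1_card -(card_imset _ (mulIg (tperm a w))).
apply/subset_leq_card/subsetP=> _ /imsetP[y + ->].
rewrite unfold_in /= !inE => /andP[/andP[yA /eqP L] /eqP ya].
move: wA; rewrite !inE => /andP[wa wA].
have ya' : y a != a by rewrite ya.
move: L; rewrite card_porbit_cut // ya => -[->]; rewrite eqxx andbT.
apply/subsetP=> u; rewrite !inE permM.
apply: contraR; rewrite negb_and negbK => /orP[/eqP->|uA].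
  by rewrite ya tpermR.
rewrite (out_perm yA uA) tpermD //; first by apply: contraNneq uA => <-.
by apply: contraNneq uA => <-.
Qed.

Lemma dvdn_card_porbit y a m : (y ^+ m) a = a -> #|porbit y a| %| m.
Proof.
set L := #|_| => ym; rewrite /dvdn.
have L0 : 0 < L by rewrite lt0n card_porbit_neq0.
have yL : (y ^+ L) a = a by rewrite permX iter_porbit.
have yLq q : (y ^+ (q * L)) a = a.
  by elim: q => [|q IHq]; rewrite ?perm1 // mulSn expgD permM yL.
have rL : m %% L < L by rewrite ltn_mod.
have : (y ^+ (m %% L)) a = a.
  by move: ym; rewrite {1}(divn_eq m L) expgD permM yLq.
rewrite permX => /eqP; have := nth_uniq a _ _ (uniq_traject_porbit y a).
move=> /(_ (m %% L) 0); rewrite size_traject => /(_ rL L0).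
by rewrite !nth_traject //= => ->.
Qed.

Lemma card_fix_ppow p e a : prime p ->
  #|[set y : {perm T} | (y ^+ (p ^ e)) a == a]|
    <= (trunc_log p #|T|).+1 * (#|T|.-1)`!.
Proof.
move=> pr_p; set k := trunc_log p #|T|.
pose B (i : 'I_k.+1) := [set y in perm_on [set: T] | #|porbit y a| == (p ^ i)%N].
have cB i : #|B i| <= (#|T|.-1)`!.
  by rewrite -cardsT; apply: card_porbit_eq_leq; rewrite inE.
apply: (@leq_trans #|\bigcup_i B i|).
  apply/subset_leq_card/subsetP=> y; rewrite inE => /eqP/dvdn_card_porbit.
  case/(dvdn_pfactor _ _ pr_p)=> i _ L.
  have ik : i < k.+1.
    by rewrite ltnS trunc_log_max ?prime_gt1 // -L max_card.
  apply/bigcupP; exists (Ordinal ik) => //.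
  by rewrite !inE L eqxx andbT; apply/subsetP=> u; rewrite inE.
rewrite -[k.+1 in X in _ <= X]card_ord -sum_nat_const.
elim/big_rec2: _ => [|i m C _ IH]; first by rewrite cards0.
by rewrite (leq_trans (leq_card_setU _ _).1) // leq_add.
Qed.

End OrbitLength.

(** * Counting by relabelling a point *)

Section Relabel.
Variable T : finType.
Implicit Types (x y : {perm T}) (a t : T).

(** The pair [(y, t)], with [t] one of at least [m] labels allowed for [y], can
    be read off from [y' := y ^ tperm (d y) t]: if [c y'] is the point [d y]
    that was relabelled and [e y'] is its new label [t], conjugating [y'] by
    the same transposition gives [y] back. *)
Lemma relabel_bound (E : {set {perm T}}) (c d e : {perm T} -> T) m
    (K : {perm T} -> {set T}) :
    (forall y, y \in E -> m <= #|K y|) ->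
    (forall y t, y \in E -> t \in K y ->
       let y' := y ^ tperm (d y) t in c y' = d y /\ e y' = t) ->
  #|E| * m <= #|{perm T}|.
Proof.
move=> Km rec.
apply: (@leq_trans (\sum_(y in E) #|K y|)).
  by rewrite -sum_nat_const; apply: leq_sum.
under eq_bigr do rewrite -sum1_card.
rewrite pair_big_dep /= sum1_card.
rewrite -(card_in_imset (f := fun u => u.1 ^ tperm (d u.1) u.2)) ?max_card //.
move=> [y t] [y1 t1] /andP[yE tK] /andP[y1E t1K] /=.
have [/= cy ey] := rec _ _ yE tK; have [/= cy1 ey1] := rec _ _ y1E t1K.
move=> eq_y'; move: cy ey; rewrite eq_y' cy1 ey1 => eq_d eq_t.
by move: eq_y'; rewrite eq_d eq_t => /conjg_inj->.
Qed.

Lemma tperm_conjX y u w P z :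
  ((y ^ tperm u w) ^+ P) (tperm u w z) = tperm u w ((y ^+ P) z).
Proof. by rewrite -conjXg permJ. Qed.

(** The point relabelled is [b], and any label except [a] is allowed: the
    power then sends [a] to the new label. *)
Lemma card_powX_eq P a b : b != a ->
  #|[set y : {perm T} | (y ^+ P) a == b]| * #|T|.-1 <= #|{perm T}|.
Proof.
move=> ba.
apply: (@relabel_bound _ (fun=> b) (fun=> b)
  (fun y => (y ^+ P) a) _ (fun=> [set~ a])) => [y _|y t].
  by rewrite cardsC1.
rewrite !inE => /eqP ya ta /=; split=> //.
by have := tperm_conjX y b t P a; rewrite ya tpermL tpermD.
Qed.

(** With [z := y ^+ P], the point relabelled is [z (x a) = x (z a)], and the
    new label avoids [a], [x a] and [z a].  The hypotheses ensure that these
    three points also differ from the old label, so the relabelled power still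
    sends [a] to [z a]: the old label is recovered as [x] of that point, and
    the new one as the image of [x a]. *)
Lemma card_powX_commute x P a : x a != a ->
  #|[set y : {perm T} | [&& (y ^+ P) (x a) == x ((y ^+ P) a),
       (y ^+ P) a != a & x ((y ^+ P) a) != a]]| * (#|T| - 3) <= #|{perm T}|.
Proof.
move=> xa.
apply: (@relabel_bound _ (fun y => x ((y ^+ P) a)) (fun y => x ((y ^+ P) a))
  (fun y => (y ^+ P) (x a)) _
  (fun y => ~: [set a; x a; (y ^+ P) a])) => [y _|y t].
  rewrite -(cardsC [set a; x a; (y ^+ P) a]) leq_subLR leq_add2r.
  by rewrite (leq_trans (leq_card_setU _ _).1) // cards1 cards2; case: eqP.
set z := y ^+ P.
rewrite !inE !negb_or => /and3P[/eqP zx za xza] /andP[/andP[ta tb] tc] /=.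
have ztau u := tperm_conjX y (x (z a)) t P u.
have dc : x (z a) != z a by rewrite -zx (inj_eq perm_inj).
have da : x (z a) != x a by rewrite (inj_eq perm_inj).
have := ztau a; rewrite -/z [tperm _ _ a]tpermD // [tperm _ _ (z a)]tpermD // => ->.
split=> //; have := ztau (x a).
by rewrite -/z [tperm _ _ (x a)]tpermD // zx tpermL.
Qed.

End Relabel.

(** * Permutations generating a nilpotent group with a given one *)

(** In a nilpotent group, elements of coprime orders commute. *)
Lemma nilpotent_commute_constt (gT : finGroupType) (v y : gT) (pi : nat_pred) :
  nilpotent <<[set v; y]>> -> commute v.`_pi (y ^+ #|[set: gT]|`_pi%N).
Proof.
move=> nilH; set P := (#|_|`_pi)%N.
have vH : v.`_pi \in <<[set v; y]>> by rewrite groupX ?mem_gen ?set21.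
have yH : y ^+ P \in <<[set v; y]>> by rewrite groupX ?mem_gen ?set22.
have yp' : pi^'.-elt (y ^+ P).
  apply: (@pnat_dvd _ (#|[set: gT]|`_pi^')%N); last exact: part_pnat.
  by rewrite order_dvdn -expgM partnC ?cardG_gt0 // -order_dvdn order_dvdG ?inE.
apply/cent1P; rewrite -cent_cycle -cycle_subG.
apply: (sub_nilpotent_cent2 nilH); rewrite ?cycle_subG //.
by rewrite coprime_sym (pnat_coprime (p_elt_constt _ _)).
Qed.

Lemma trunc_log_bound p n : prime p -> 19 <= n -> 8 * (trunc_log p n).+1 <= 3 * n.
Proof.
move=> pr_p n19; have p1 := prime_gt1 pr_p.
have pkn : (p ^ trunc_log p n <= n)%N by apply: trunc_logP => //; lia.
move: (trunc_log p n) pkn => k pkn.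
have [k4|k4] := leqP k 4; first by clear pkn; lia.
have k2n : (2 ^ k <= n)%N.
  by apply: leq_trans pkn; case: k k4 => // k _; rewrite leq_exp2r.
suff : (8 * k.+1 <= 3 * 2 ^ k)%N by move/leq_trans; apply; rewrite leq_mul2l.
clear pkn k2n; elim: k k4 => // k IH; rewrite ltnS leq_eqVlt => /predU1P[<- //|/IH].
by rewrite (expnS 2); lia.
Qed.

Lemma card_nilpotent_pair n (v : 'S_n) : 19 <= n -> v != 1 ->
  2 * #|[set y : 'S_n | nilpotent <<[set v; y]>>]| <= n`!.
Proof.
move=> n19 v1.
have [p pr_p pv] : exists2 p, prime p & p %| #[v].
  by exists (pdiv #[v]); rewrite ?pdiv_dvd ?pdiv_prime // order_gt1.
set x := v.`_p.
have x1 : x != 1.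
  rewrite -order_gt1 order_constt p_part -(expn0 p) ltn_exp2l ?prime_gt1 //.
  by rewrite logn_gt0 mem_primes pr_p pv order_gt0.
have [a xa] : exists a, x a != a.
  apply/existsP; apply: contraR x1; rewrite negb_exists => /forallP fix_x.
  by apply/eqP/permP=> a; rewrite perm1; apply/eqP; have := fix_x a; rewrite negbK.
pose P := (#|[set: 'S_n]|`_p)%N.
have xVa : x^-1 a != a by rewrite -(inj_eq (@perm_inj _ x)) permKV eq_sym.
have cF := card_fix_ppow (logn p #|[set: 'S_n]|) a pr_p.
rewrite -p_part -/P in cF.
have cE1 := card_powX_eq P xVa; have cE2 := card_powX_commute P xa.
set F := [set y | _ == a] in cF; set E1 := [set y | _ == _] in cE1.
set E2 := [set y | [&& _, _ & _]] in cE2.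
set N := [set y : 'S_n | _].
have sN : N \subset F :|: (E1 :|: E2).
  apply/subsetP=> y; rewrite !inE => /(nilpotent_commute_constt p).
  rewrite -/x -/P => /permP/(_ a); rewrite !permM => ->; rewrite eqxx /=.
  rewrite -[(y ^+ P) a == x^-1 a](inj_eq (@perm_inj _ x)) permKV.
  by case: (_ == a); case: (_ == a).
have cN : #|N| <= #|F| + (#|E1| + #|E2|).
  apply: leq_trans (subset_leq_card sN) _.
  apply: leq_trans (leq_card_setU _ _).1 _.
  by rewrite leq_add2l (leq_card_setU _ _).1.
have factE m : 0 < m -> m`! = (m * m.-1`!)%N by case: m.
move: cF cE1 cE2; rewrite card_ord card_Sn (factE n); last by lia.
set q := n.-1`!; set k := (trunc_log p n).+1 => cF cE1 cE2.
have kq : 8 * (k * q) <= 3 * (n * q).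
  by rewrite !mulnA leq_mul2r trunc_log_bound ?orbT.
have E1_18 : #|E1| * 18 <= #|E1| * n.-1 by rewrite leq_mul2l; lia.
have E2_16 : #|E2| * 16 <= #|E2| * (n - 3) by rewrite leq_mul2l; lia.
lia.
Qed.

(** * The minimum degree *)

Lemma isolated1 (gT : finGroupType) : isolated (@nonnil_rel gT) 1.
Proof.
apply/forallP=> w; rewrite /nonnil_rel /= negbK abelian_nil //.
apply: abelianS (cycle_abelian w).
by rewrite gen_subG subUset !sub1set group1 cycle_id.
Qed.

(** No neighbour is lost in passing to the induced subgraph, since a neighbour
    of [v] is not isolated. *)
Lemma degree_Rgraph (gT : finGroupType) (v : Rvertex gT) :
  degree (@Rgraph gT) v = #|[set y | ~~ nilpotent <<[set val v; y]>>]|.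
Proof.
rewrite /degree -(card_imset _ val_inj); apply: eq_card => y; rewrite !inE.
apply/imsetP/idP => [[w + ->]|vy]; first by rewrite inE.
have yR : ~~ isolated (@nonnil_rel _) y.
  rewrite negb_forall; apply/existsP; exists (val v).
  by rewrite negbK nonnil_rel_sym.
by exists (Sub y yR); rewrite ?inE.
Qed.

Theorem theorem4p1 (n : nat) (hn : (19 <= n)%N) (v : Rvertex 'S_n) :
  (1 / 2%:R * (n`!)%:R <= (degree (@Rgraph 'S_n) v)%:R :> rat)%R.
Proof.
have v1 : val v != 1 by apply: contraNneq (valP v) => ->; exact: isolated1.
have half := card_nilpotent_pair hn v1.
have deg : #|[set y : 'S_n | nilpotent <<[set val v; y]>>]|
    + degree (@Rgraph _) v = n`!.
  rewrite degree_Rgraph -card_Sn -(cardsC [set y | nilpotent <<[set val v; y]>>]).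
  by congr (_ + _); apply: eq_card => y; rewrite !inE.
rewrite GRing.mul1r GRing.mulrC Num.Theory.ler_pdivrMr //.
rewrite -GRing.natrM Num.Theory.ler_nat; move: half.
by rewrite -deg mul2n -addnn leq_add2l muln2 -addnn leq_add2r.
Qed.
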